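(* Let $m\ge k\ge 1$ and $i\ge 1$ be integers. The generating function $$f_{(m,k,1),i}(q)=\sum_{\substack{T\in SYT((m,k,1))\\ |\mathrm{Des}(T)|=i}} q^{\mathrm{maj}(T)}$$ satisfies, as an identity of rational functions in $q$, $$f_{(m,k,1),i}(q) = q^{k+i^2-2i+2}\, \frac{(1-q^{m-k+1})(1-q^{i-1})}{(1-q^i)(1-q)}\left[ {k \atop i-1} \right]_q \left[ {m+1 \atop i-1} \right]_q.$$
   Context: For a partition $\lambda$ of $n$, $SYT(\lambda)$ denotes the set of standard Young tableaux of shape $\lambda$: fillings of the Ferrers diagram of $\lambda$ (row 1 on top, with $\lambda_1$ boxes, row 2 below it with $\lambda_2$ boxes, and so on, left-justified) with the numbers $1,\dots,n$, each used once, such that entries increase along rows to the right and down columns. Here $n=m+k+1$. The descent set $\mathrm{Des}(T)$ is the set of $j\in\{1,\dots,n-1\}$ such that $j$ lies in a strictly higher row than $j+1$ (i.e. $j+1$ lies in a row strictly below that of $j$), and $\mathrm{maj}(T)=\sum_{j\in \mathrm{Des}(T)} j$. With $(q)_N=(1-q)(1-q^2)\cdots(1-q^N)$ and $(q)_0=1$, the $q$-binomial coefficient is $\left[ {A \atop B} \right]_q=\frac{(q)_A}{(q)_B(q)_{A-B}}$ for integers $0\le B\le A$, and $\left[ {A \atop B} \right]_q=0$ for $0\le A<B$. *)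

(* Defs.v *)
From HB Require Import structures.
From mathcomp Require Import all_boot all_order all_algebra.

Set Implicit Arguments.
Unset Strict Implicit.
Unset Printing Implicit Defensive.

Import GRing.Theory.

Local Open Scope ring_scope.

Notation "x %:F" := (@tofrac _ x) : ring_scope.

(* A partition is the sequence of its row lengths; rows and columns are
   numbered from 0, row 0 being the top one. *)
Definition cell (sh : seq nat) : finType := {r : 'I_(size sh) & 'I_(nth 0%N sh r)}.

Definition row_of (sh : seq nat) (c : cell sh) : nat := tag c.
Definition col_of (sh : seq nat) (c : cell sh) : nat := tagged c.

(* A filling is stored with values in 'I_n, n = sumn sh; the entry written in
   the box c is the shifted value in {1, ..., n}. *)
Definition filling (sh : seq nat) : finType := {ffun cell sh -> 'I_(sumn sh)}.

Definition entry (sh : seq nat) (T : filling sh) (c : cell sh) : nat := (T c).+1.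

Definition each_used_once (sh : seq nat) (T : filling sh) : bool :=
  [forall v : 'I_(sumn sh), #|[set c | entry T c == v.+1]| == 1%N].

Definition row_increasing (sh : seq nat) (T : filling sh) : bool :=
  [forall c : cell sh, forall d : cell sh,
     (row_of c == row_of d) && (col_of c < col_of d)%N
       ==> (entry T c < entry T d)%N].

Definition col_increasing (sh : seq nat) (T : filling sh) : bool :=
  [forall c : cell sh, forall d : cell sh,
     (col_of c == col_of d) && (row_of c < row_of d)%N
       ==> (entry T c < entry T d)%N].

Definition SYT (sh : seq nat) : {set filling sh} :=
  [set T : filling sh |
    [&& each_used_once T, row_increasing T & col_increasing T]].

(* Unlike the values of a filling, the elements j of Des T are not shifted:
   j = 0 never qualifies because entries are positive. *)
Definition Des (sh : seq nat) (T : filling sh) : {set 'I_(sumn sh)} :=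
  [set j : 'I_(sumn sh) |
    [exists c : cell sh, exists d : cell sh,
      [&& entry T c == j, entry T d == j.+1 & (row_of c < row_of d)%N]]].

Definition maj (sh : seq nat) (T : filling sh) : nat := (\sum_(j in Des T) j)%N.

Definition des_maj_gf (R : nzRingType) (q : R) (sh : seq nat) (i : nat) : R :=
  \sum_(T in SYT sh | #|Des T| == i) q ^+ maj T.

Definition qpoch (R : nzRingType) (q : R) (N : nat) : R :=
  \prod_(1 <= j < N.+1) (1 - q ^+ j).

Definition qbinom (F : fieldType) (q : F) (A B : nat) : F :=
  if (B <= A)%N then qpoch q A / (qpoch q B * qpoch q (A - B)) else 0.

(* The field Q(q); qvar is the indeterminate q. *)
Definition ratfun : fieldType := {fraction {poly rat}}.
Definition qvar : ratfun := 'X%:F.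

(* Main.v *)
Require Import Defs.
From HB Require Import structures.
From mathcomp Require Import all_boot all_order all_algebra.
From mathcomp Require Import zify ring.
Set Implicit Arguments.
Unset Strict Implicit.
Unset Printing Implicit Defensive.
Import GRing.Theory.
Local Open Scope ring_scope.

(* A standard tableau is the same thing as the lattice word whose [j]-th letter
   is the row of [j]; [j] is a descent when letter [j+1] exceeds letter [j].
   Removing the last letter from words of content [(m, k, 1)], and tracking
   whether this destroys a descent, gives
     f(m,k,1;i) = f(m-1,k,1;i) + f(m,k-1,1;i) - f(m-1,k-1,1;i)
                  + q^(m+k) (f(m-1,k-1,1;i-1) + f(m,k;i-1)),
   because a final letter 0 never creates a descent and a final letter 2 always
   does.  Two-row shapes satisfy the analogous recursion, and the closed forms
   solve both: after dividing by common q-binomials these are identities of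
   rational functions in q, q^m, q^k and q^i. *)

(** * Reversed words and the lattice condition *)

Fixpoint words (d n : nat) : seq (seq nat) :=
  if n is n'.+1 then [seq x :: w | x <- iota 0 d, w <- words d n'] else [:: [::]].

(* Words are stored reversed: the head of the list is the last letter, so the
   tails of [w] are the prefixes on which the lattice condition is imposed. *)
Fixpoint lattice (d : nat) (w : seq nat) : bool :=
  if w is _ :: w' then
    lattice d w' && all (fun r => count_mem r.+1 w <= count_mem r w)%N (iota 0 d.-1)
  else true.

Definition content (d : nat) (w : seq nat) : seq nat :=
  [seq count_mem r w | r <- iota 0 d].

(** The letter [x] stands at position [size w' + 1], so a descent it creates is at [size w']; the
    default of [head] keeps the first letter of the word from counting. Taking [F] constantly 1
    counts descents, and [F := id] gives the major index. *)
Fixpoint descent_sum (F : nat -> nat) (w : seq nat) : nat :=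
  if w is x :: w' then
    ((if head x w' < x then F (size w') else 0) + descent_sum F w')%N
  else 0%N.

(* When every entry is used once the sum has exactly one term. *)
Definition row_at (sh : seq nat) (T : filling sh) (j : nat) : nat :=
  (\sum_(c | T c == j :> nat) row_of c)%N.

Fixpoint row_word (sh : seq nat) (T : filling sh) (j : nat) : seq nat :=
  if j is j'.+1 then row_at T j' :: row_word T j' else [::].

Lemma mem_words d n w :
  (w \in words d n) = (size w == n) && all (fun x => x < d)%N w.
Proof.
elim: n w => [|n IH] [|x w] //=.
  by apply/allpairsP => -[[y v] [_ _]].
apply/allpairsP/idP => [[[y v] /= [hy hv [-> ->]]]|].
  by move: hv hy; rewrite IH mem_iota add0n eqSS /= => /andP[-> ->] ->.
rewrite eqSS => /and3P[hs hx ha]; exists (x, w) => /=.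
by rewrite IH mem_iota add0n hs ha /=.
Qed.

Lemma words_uniq d n : uniq (words d n).
Proof.
elim: n => //= n IH; apply: allpairs_uniq => //; first exact: iota_uniq.
by move=> [x v] [y u] _ _ [-> ->].
Qed.

Lemma drop_rev_step (w : seq nat) j : (j < size w)%N ->
  drop (size w - j.+1) w = nth 0%N w (size w - j.+1) :: drop (size w - j) w.
Proof.
by move=> hj; rewrite (drop_nth 0%N) ?subnSK //; lia.
Qed.

Lemma lattice_drop d w k : lattice d w -> lattice d (drop k w).
Proof. by elim: w k => [|x w IH] [|k] //= /andP[/IH ? _]. Qed.

Lemma lattice_count d w r s : lattice d w -> (r <= s)%N -> (s < d)%N ->
  (count_mem s w <= count_mem r w)%N.
Proof.
case: w => [|x w] // /andP[_ /allP h].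
elim: s => [|s IH]; first by rewrite leqn0 => /eqP ->.
rewrite leq_eqVlt => /predU1P[-> //|hrs] hs.
apply: leq_trans (IH hrs (ltnW hs)); apply: h.
by rewrite mem_iota /= add0n; lia.
Qed.

(** * The bijection between standard tableaux and lattice words *)

Section Cells.
Variable sh : seq nat.
Implicit Types (c e : cell sh) (T : filling sh).

Lemma cell_inj c e : row_of c = row_of e -> col_of c = col_of e -> c = e.
Proof.
case: c e => [r x] [s y]; rewrite /row_of /col_of /= => /val_inj hrs.
by subst s => /val_inj ->.
Qed.

Lemma cell_ex r x : (r < size sh)%N -> (x < nth 0%N sh r)%N ->
  exists c, row_of c = r /\ col_of c = x.
Proof.
move=> hr hx.
by exists (@existT _ (fun r : 'I_(size sh) => 'I_(nth 0%N sh r)) (Ordinal hr) (Ordinal hx)).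
Qed.

Lemma row_lt c : (row_of c < size sh)%N.
Proof. exact: ltn_ord. Qed.

Lemma col_lt c : (col_of c < nth 0%N sh (row_of c))%N.
Proof. exact: ltn_ord. Qed.

Lemma each_used_onceP T :
  reflect (injective T /\ forall v, exists c, T c = v) (each_used_once T).
Proof.
apply: (iffP forallP) => [h|[inj ex] v].
  have h1 v : exists c, forall e, (T e == v) = (e == c).
    have /cards1P[c hc] := h v; exists c => e.
    by move/setP/(_ e): hc; rewrite !inE /entry eqSS -val_eqE.
  split=> [c e hce|v].
    have [a ha] := h1 (T c); have := ha c; have := ha e.
    by rewrite -hce eqxx => /esym/eqP -> /esym/eqP ->.
  by have [c hc] := h1 v; exists c; apply/eqP; rewrite hc.
have [c hc] := ex v; apply/cards1P; exists c; apply/setP => e.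
by rewrite !inE /entry eqSS; apply/eqP/eqP => [/val_inj|->]; rewrite -hc // => /inj.
Qed.

Lemma row_atE T c : each_used_once T -> row_at T (T c) = row_of c.
Proof.
case/each_used_onceP => inj _; rewrite /row_at (big_pred1 c) // => e /=.
by rewrite val_eqE inj_eq.
Qed.

Lemma size_row_word T j : size (row_word T j) = j.
Proof. by elim: j => //= j ->. Qed.

Lemma descent_sum_row_word T j F :
  descent_sum F (row_word T j) =
  (\sum_(x < j | (0 < x) && (row_at T x.-1 < row_at T x)) F x)%N.
Proof.
elim: j => [|j IH] /=; first by rewrite big_ord0.
rewrite big_mkcond big_ord_recr /= -big_mkcond -IH addnC size_row_word.
by case: j {IH} => [|j] //=; rewrite ltnn.
Qed.

(** Stored values are one below entries: for a descent [x], the entries [x] and [x + 1] are the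
    stored values [x.-1] and [x], whose rows are adjacent letters of the word. *)
Lemma sum_Des T (F : nat -> nat) : each_used_once T ->
  (\sum_(x in Des T) F x = descent_sum F (row_word T (sumn sh)))%N.
Proof.
move=> hT; have /each_used_onceP[_ ex] := hT; rewrite descent_sum_row_word.
apply: eq_bigl => x; rewrite inE.
apply/existsP/andP => [[c /existsP[e /and3P[/eqP hc /eqP he hlt]]]|[hx hlt]].
  have -> : (x : nat) = T e by case: he.
  rewrite row_atE // -(_ : T c = (T e).-1 :> nat) ?row_atE //; first by split=> //; case: he hc => -> <-.
  by case: he hc => -> <-.
have hp : (x.-1 < sumn sh)%N by apply: leq_ltn_trans (leq_pred _) (ltn_ord x).
have [c hc] := ex (Ordinal hp); have [e he] := ex x.
exists c; apply/existsP; exists e.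
rewrite /entry hc he /= prednK // !eqxx /=.
by rewrite -!(row_atE _ hT) hc he.
Qed.

(* The values below [j] occupy an initial segment of each row [r], whose length
   is the number of letters [r] in the prefix of length [j]. *)
Lemma entry_ltE T c j : each_used_once T -> row_increasing T -> (j <= sumn sh)%N ->
  (T c < j)%N = (col_of c < count_mem (row_of c) (row_word T j))%N.
Proof.
move=> hT /forallP hrow; have /each_used_onceP[inj ex] := hT.
have {}hrow a b : row_of a = row_of b -> (col_of a < col_of b)%N -> (T a < T b)%N.
  move=> h1 h2; have /forallP/(_ b) := hrow a.
  by rewrite h1 eqxx h2 /entry ltnS.
elim: j c => [|j IH] c hj; first by rewrite ltn0.
have [e he] := ex (Ordinal hj); have {}IH c := IH c (ltnW hj).
have he' : T e = j :> nat by rewrite he.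
(* The box holding [j] is the first one after the initial segment of its row: any further right, the
   box [f] at the end of the segment would hold a value below [j] without belonging to the
   segment. *)
have col_e : col_of e = count_mem (row_of e) (row_word T j).
  apply/eqP; rewrite eqn_leq leqNgt; apply/andP; split.
    apply/negP => hlt.
    have [f [hf1 hf2]] := cell_ex (row_lt e) (ltn_trans hlt (col_lt e)).
    have := hrow f e hf1; rewrite hf2 he' => /(_ hlt).
    by rewrite IH hf1 hf2 ltnn.
  by rewrite leqNgt -IH he' ltnn.
rewrite /= -he' row_atE // ltnS leq_eqVlt he' IH.
have -> : (T c == j :> nat) = (c == e) by rewrite -he' val_eqE inj_eq.
have [->|hce] := eqVneq c e; first by rewrite !eqxx col_e add1n ltnSn.
rewrite /=; have [hr|hr] /= := eqVneq (row_of e) (row_of c); last by rewrite add0n.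
rewrite add1n ltnS [RHS]leq_eqVlt -hr -col_e orbC; case: eqP => [hcol|]; last by rewrite orbF.
by case/eqP: hce; apply: cell_inj.
Qed.

Lemma row_at_lt T j : each_used_once T -> (j < sumn sh)%N -> (row_at T j < size sh)%N.
Proof.
move=> hT hj; have /each_used_onceP[_ /(_ (Ordinal hj))[c hc]] := hT.
have -> : j = T c by rewrite hc.
by rewrite row_atE // row_lt.
Qed.

Lemma row_word_words T : each_used_once T ->
  row_word T (sumn sh) \in words (size sh) (sumn sh).
Proof.
move=> hT; rewrite mem_words size_row_word eqxx /=.
elim: {1 3}(sumn sh) (leqnn (sumn sh)) => //= j IH hj.
by rewrite row_at_lt //= IH // ltnW.
Qed.

Lemma count_row_word_le T r j : each_used_once T -> row_increasing T ->
  (j <= sumn sh)%N -> (count_mem r (row_word T j) <= nth 0%N sh r)%N.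
Proof.
move=> hT hrow; elim: j => //= j IH hj; have /IH {}IH := ltnW hj.
have [hr|] := eqVneq; last by rewrite add0n.
have /each_used_onceP[_ /(_ (Ordinal hj))[c hc]] := hT.
have hc' : T c = j :> nat by rewrite hc.
rewrite -hr -hc' row_atE // add1n.
have := col_lt c; have := entry_ltE c hT hrow (ltnW hj); rewrite hc' ltnn => /esym/negbT.
by rewrite -leqNgt => h1 h2; apply: leq_ltn_trans h1 h2.
Qed.

Lemma content_row_word T : each_used_once T -> row_increasing T ->
  content (size sh) (row_word T (sumn sh)) = sh.
Proof.
move=> hT hrow; apply: (@eq_from_nth _ 0%N) => [|r].
  by rewrite size_map size_iota.
rewrite size_map size_iota => hr.
rewrite (nth_map 0%N) ?size_iota // nth_iota // add0n.
apply/eqP; rewrite eqn_leq count_row_word_le //= leqNgt; apply/negP => hlt.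
have [c [hc1 hc2]] := cell_ex hr hlt.
by have := entry_ltE c hT hrow (leqnn _); rewrite ltn_ord hc1 hc2 ltnn.
Qed.

(** If a prefix had more letters [r.+1] than [r], some box of row [r.+1] would already be filled
    while the box above it is not, against column increase. *)
Lemma lattice_row_word T j : sorted geq sh -> T \in SYT sh -> (j <= sumn sh)%N ->
  lattice (size sh) (row_word T j).
Proof.
move=> hsh; rewrite inE => /and3P[hT hrow /forallP hcol].
elim: j => [//|j IH hj].
rewrite /= (IH (ltnW hj)) andTb.
apply/allP => r _; rewrite -/(count_mem r.+1 (row_word T j.+1)) -/(count_mem r (row_word T j.+1)).
rewrite leqNgt; apply/negP => hlt.
have hx := leq_trans hlt (count_row_word_le r.+1 hT hrow hj).
have hr : (r.+1 < size sh)%N.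
  by rewrite ltnNge; apply/negP => h; rewrite nth_default in hx.
have hge : (nth 0%N sh r.+1 <= nth 0%N sh r)%N.
  have /sortedP := hsh; exact.
have [c [hc1 hc2]] := cell_ex hr hx.
have [e [he1 he2]] := cell_ex (ltnW hr) (leq_trans hx hge).
have /forallP/(_ c) := hcol e.
rewrite hc1 hc2 he1 he2 eqxx ltnSn /entry ltnS /= => hec.
have := entry_ltE e hT hrow hj; rewrite he1 he2 ltnn => /negP[].
by apply: ltn_trans hec _; rewrite entry_ltE // hc1 hc2.
Qed.

(** By [entry_ltE] the word alone decides every comparison [T c < j], and these comparisons
    determine [T c]. *)
Lemma row_word_inj : {in SYT sh &, injective (fun T => row_word T (sumn sh))}.
Proof.
move=> T U; rewrite !inE => /and3P[hT hTr _] /and3P[hU hUr _] heq.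
have hj j : (j <= sumn sh)%N -> row_word T j = row_word U j.
  move: heq; elim: (sumn sh) => [|n IH] /=; first by rewrite leqn0 => _ /eqP ->.
  by case=> h1 h2; rewrite leq_eqVlt => /predU1P[->|/IH ->] //=; rewrite h1 h2.
have key c j : (j <= sumn sh)%N -> (T c < j)%N = (U c < j)%N.
  by move=> h; rewrite (entry_ltE c hT hTr h) (entry_ltE c hU hUr h) hj.
apply/ffunP => c; apply/val_inj/eqP; rewrite eqn_leq /=.
have := key c _ (ltn_ord (T c)); have := key c _ (ltn_ord (U c)).
by rewrite !ltnSn !ltnS => -> <-.
Qed.

(* The cell in row [r] and column [x] receives the position of the [x]-th
   letter [r] of the word. *)
Lemma row_word_surj w : w \in words (size sh) (sumn sh) ->
  lattice (size sh) w -> content (size sh) w = sh ->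
  exists2 T : filling sh, T \in SYT sh & row_word T (sumn sh) = w.
Proof.
rewrite mem_words => /andP[/eqP hsz hall] hlat hcont.
set n := sumn sh in hsz *.
(* As words are reversed, [sfx j] is the prefix of the first [j] letters and [letter j] is the
   letter that follows it. *)
pose sfx j := drop (n - j) w; pose letter j := nth 0%N w (n - j.+1).
have sfxS j : (j < n)%N -> sfx j.+1 = letter j :: sfx j.
  by move=> hj; rewrite /sfx /letter -hsz drop_rev_step // hsz.
have sfx0 : sfx 0%N = [::] by rewrite /sfx subn0 -hsz drop_size.
have sfxn : sfx n = w by rewrite /sfx subnn drop0.
have cw r : (r < size sh)%N -> count_mem r w = nth 0%N sh r.
  move=> hr; rewrite -[in RHS]hcont (nth_map 0%N) ?size_iota // nth_iota //.
have cntS r j : (j < n)%N -> count_mem r (sfx j.+1) = ((letter j == r) + count_mem r (sfx j))%N.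
  by move=> hj; rewrite sfxS.
have mono r i j : (i <= j)%N -> (j <= n)%N -> (count_mem r (sfx i) <= count_mem r (sfx j))%N.
  move=> hij hj; elim: j hij hj => [|j IH]; first by rewrite leqn0 => /eqP ->.
  rewrite leq_eqVlt => /predU1P[-> //|hij] hj.
  by apply: leq_trans (IH hij (ltnW hj)) _; rewrite cntS // leq_addl.
(* Along the prefixes the count of [row_of c] climbs by steps of at most one from 0 to the row
   length, so it leaves the value [col_of c] at some position. *)
have hex c : exists p : 'I_n,
    (count_mem (row_of c) (sfx p) == col_of c) && (letter p == row_of c).
  have := col_lt c; rewrite -cw ?row_lt // -sfxn.
  suff gen j : (j <= n)%N -> (col_of c < count_mem (row_of c) (sfx j))%N ->
      exists p : 'I_n, (count_mem (row_of c) (sfx p) == col_of c) && (letter p == row_of c).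
    exact: gen.
  elim: j => [|j IH] hj; first by rewrite sfx0.
  case: (ltnP (col_of c) (count_mem (row_of c) (sfx j))) => [h1|h1].
    by move=> _; apply: IH h1; apply: ltnW.
  rewrite cntS //; case: eqP => [hl|_]; last by rewrite ltnNge h1.
  rewrite add1n ltnS => h2; exists (Ordinal hj) => /=.
  by rewrite hl eqxx andbT eqn_leq h1 h2.
pose T : filling sh := [ffun c => xchoose (hex c)].
have hT c : count_mem (row_of c) (sfx (T c)) = col_of c /\ letter (T c) = row_of c.
  by rewrite ffunE; have /andP[/eqP -> /eqP ->] := xchooseP (hex c).
have Tlt c j : (j <= n)%N -> (T c < j)%N = (col_of c < count_mem (row_of c) (sfx j))%N.
  move=> hj; have [h1 h2] := hT c; apply/idP/idP => h.
    by apply: leq_trans (mono _ _ _ h hj); rewrite cntS // h2 eqxx h1.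
  rewrite ltnNge; apply/negP => h3; have := mono (row_of c) _ _ h3 (ltnW (ltn_ord _)).
  by rewrite h1 leqNgt h.
have used : each_used_once T.
  apply/each_used_onceP; split=> [c e hce|v].
    have [h1 h2] := hT c; have [h3 h4] := hT e.
    have hr : row_of c = row_of e by rewrite -h2 -h4 hce.
    by apply: cell_inj => //; rewrite -h1 -h3 hr hce.
  have hr : (letter v < size sh)%N.
    by apply: (allP hall); apply: mem_nth; rewrite hsz; have := ltn_ord v; lia.
  have hx : (count_mem (letter v) (sfx v) < nth 0%N sh (letter v))%N.
    rewrite -cw // -sfxn; apply: leq_trans (mono _ _ _ (ltn_ord v) (leqnn n)).
    by rewrite cntS // eqxx.
  have [c [hc1 hc2]] := cell_ex hr hx; exists c; apply/val_inj/eqP => /=.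
  rewrite eqn_leq -ltnS Tlt // cntS // hc1 hc2 eqxx ltnSn /=.
  by rewrite leqNgt Tlt ?hc1 ?hc2 ?ltnn // ltnW.
have letterT j : (j < n)%N -> row_at T j = letter j.
  move=> hj; have /each_used_onceP[_ /(_ (Ordinal hj))[c hc]] := used.
  have -> : j = T c by rewrite hc.
  by rewrite row_atE //; have [_ ->] := hT c.
exists T; last first.
  suff gen j : (j <= n)%N -> row_word T j = sfx j by rewrite -sfxn gen.
  elim: j => [|j IH] hj //=.
  by rewrite sfxS // letterT // IH // ltnW.
rewrite inE used /=; apply/andP; split; apply/forallP => c; apply/forallP => e.
  apply/implyP => /andP[/eqP hr hcol]; rewrite /entry ltnS Tlt ?(ltnW (ltn_ord _)) // hr.
  by have [-> _] := hT e.
apply/implyP => /andP[/eqP hcol hr]; rewrite /entry ltnS Tlt ?(ltnW (ltn_ord _)) //.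
have [h1 h2] := hT e.
(* The prefix ending with the letter of the lower box [e] has [col_of e + 1] letters [row_of e],
   hence at least as many letters [row_of c]; its last letter is not one of these, so [c] was filled
   before [e]. *)
have lat : lattice (size sh) (sfx (T e).+1) by apply: lattice_drop.
have := lattice_count lat (ltnW hr) (row_lt e).
by rewrite !cntS // h2 eqxx [_ == row_of c]gtn_eqF // h1 hcol.
Qed.

Lemma row_word_SYT : sorted geq sh ->
  perm_eq [seq row_word T (sumn sh) | T <- enum (SYT sh)]
    [seq w <- words (size sh) (sumn sh) |
       lattice (size sh) w && (content (size sh) w == sh)].
Proof.
move=> hsh; apply: uniq_perm.
- rewrite map_inj_in_uniq ?enum_uniq // => T U; rewrite !mem_enum; exact: row_word_inj.
- exact/filter_uniq/words_uniq.
move=> w; rewrite mem_filter; apply/mapP/idP => [[T]|/andP[/andP[h1 /eqP h2] h3]].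
  rewrite mem_enum => hT ->; rewrite lattice_row_word //=.
  move: hT; rewrite inE => /and3P[h1 h2 _].
  by rewrite content_row_word // eqxx row_word_words.
by have [T hT <-] := row_word_surj h3 h1 h2; exists T; rewrite ?mem_enum.
Qed.

End Cells.

(** * Generating functions as sums over words; removal of the last letter *)

Lemma des_maj_gf_words (R : nzRingType) (q : R) sh i : sorted geq sh ->
  des_maj_gf q sh i =
  \sum_(w <- words (size sh) (sumn sh) |
      lattice (size sh) w && (content (size sh) w == sh) &&
      (descent_sum (fun=> 1%N) w == i)) q ^+ descent_sum id w.
Proof.
move=> hsh; rewrite -big_filter_cond -(perm_big _ (row_word_SYT hsh)) big_map.
rewrite /des_maj_gf -[LHS]big_enum_cond /= big_seq_cond [RHS]big_seq_cond.
have used T : T \in enum (SYT sh) -> each_used_once T.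
  by rewrite mem_enum inE => /and3P[].
apply: eq_big => [T|T /andP[hT _]]; last by rewrite /maj (sum_Des id) ?used.
by have [hT|//] := boolP (T \in _); rewrite -(sum_Des (fun=> 1%N)) ?used // sum1_card.
Qed.

Lemma sum_words_cons (R : nzRingType) d n (P : pred (seq nat)) (f : seq nat -> R) :
  \sum_(w <- words d n.+1 | P w) f w =
  \sum_(x <- iota 0 d) \sum_(w <- words d n | P (x :: w)) f (x :: w).
Proof.
rewrite big_mkcond [LHS]big_allpairs_dep; apply: eq_bigr => x _.
by rewrite [RHS]big_mkcond.
Qed.

Definition shape3 (a b c : nat) (w : seq nat) : bool :=
  lattice 3 w && (content 3 w == [:: a; b; c]).

Lemma lattice3_le w : lattice 3 w ->
  (count_mem 1 w <= count_mem 0 w)%N && (count_mem 2 w <= count_mem 1 w)%N.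
Proof. by move=> h; rewrite !(lattice_count h). Qed.

Lemma shape3_le a b c w : shape3 a b c w -> (c <= b <= a)%N.
Proof.
by case/andP => /lattice3_le h /eqP [<- <- <-]; rewrite andbC.
Qed.

(** Appending 0 never breaks the lattice condition, whereas appending 1 or 2 needs a strict
    inequality in the content; this is the source of the hypotheses of the next two lemmas. *)
Lemma shape3_cons0 a b c w : shape3 a.+1 b c (0%N :: w) = shape3 a b c w.
Proof.
rewrite /shape3 /= !eqseq_cons; case hl: (lattice 3 w) => //=.
have := lattice3_le hl.
move: (count_mem 0 w) (count_mem 1 w) (count_mem 2 w) => x y z; lia.
Qed.

Lemma shape3_cons1 a b c w : (b < a)%N -> shape3 a b.+1 c (1%N :: w) = shape3 a b c w.
Proof.
move=> hab; rewrite /shape3 /= !eqseq_cons; case hl: (lattice 3 w) => //=.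
have := lattice3_le hl.
move: (count_mem 0 w) (count_mem 1 w) (count_mem 2 w) => x y z; lia.
Qed.

Lemma shape3_cons2 a b c w : (c < b)%N -> shape3 a b c.+1 (2%N :: w) = shape3 a b c w.
Proof.
move=> hab; rewrite /shape3 /= !eqseq_cons; case hl: (lattice 3 w) => //=.
have := lattice3_le hl.
move: (count_mem 0 w) (count_mem 1 w) (count_mem 2 w) => x y z; lia.
Qed.

Lemma shape3_cons1_0 a c w : shape3 a 0 c (1%N :: w) = false.
Proof. by rewrite /shape3 /= !eqseq_cons add1n /= !andbF. Qed.

Lemma shape3_cons2_0 a b w : shape3 a b 0 (2%N :: w) = false.
Proof. by rewrite /shape3 /= !eqseq_cons /= !andbF. Qed.

(** * Recursions for three-letter words *)

Notation des := (descent_sum (fun=> 1%N)).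
Notation wmaj := (descent_sum id).

Section GF.
Variables (F : fieldType) (q : F).
Hypothesis q0 : q != 0.
Hypothesis qn : forall n, 1 - q ^+ n.+1 != 0.

Definition word_gf (n a b c i : nat) : F :=
  \sum_(w <- words 3 n | shape3 a b c w && (des w == i)) q ^+ wmaj w.

(* The part of [word_gf n.+1] coming from words with last letter [x]. *)
Definition word_gf_last (x n a b c i : nat) : F :=
  \sum_(w <- words 3 n | shape3 a b c (x :: w) && (des (x :: w) == i))
     q ^+ wmaj (x :: w).

(** The effect of one new descent at position [n]: multiplication by $q^n t$ when $t$ marks the
    number of descents. *)
Definition shift (n : nat) (g : nat -> F) (i : nat) : F :=
  if i is j.+1 then q ^+ n * g j else 0.

Lemma word_gf_split n a b c i :
  word_gf n.+1 a b c i = word_gf_last 0 n a b c i + word_gf_last 1 n a b c i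
                         + word_gf_last 2 n a b c i.
Proof. by rewrite /word_gf sum_words_cons !big_cons big_nil addr0 addrA. Qed.

Lemma sum_words_descent x y n (P : pred (seq nat)) i : (y < x)%N ->
  \sum_(w <- words 3 n | P w && (des [:: x, y & w] == i)) q ^+ wmaj [:: x, y & w] =
  shift n.+1 (fun j => \sum_(w <- words 3 n | P w && (des (y :: w) == j))
                         q ^+ wmaj (y :: w)) i.
Proof.
move=> hyx; case: i => [|i]; rewrite [shift _ _ _]/=.
  by rewrite big_pred0 // => w; rewrite [des (x :: _)]/= hyx add1n andbF.
rewrite mulr_sumr big_seq_cond [RHS]big_seq_cond; apply: eq_big => [w|w].
  by rewrite [des (x :: _)]/= hyx add1n eqSS.
case/andP; rewrite mem_words => /andP[/eqP hw _] _.
by rewrite [wmaj (x :: _)]/= hyx hw exprD.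
Qed.

Lemma sum_words_ascent x y n (P : pred (seq nat)) i : (x <= y)%N ->
  \sum_(w <- words 3 n | P w && (des [:: x, y & w] == i)) q ^+ wmaj [:: x, y & w] =
  \sum_(w <- words 3 n | P w && (des (y :: w) == i)) q ^+ wmaj (y :: w).
Proof.
move=> hxy; apply: eq_big => w; first by rewrite [des (x :: _)]/= ltnNge hxy.
by move=> _; rewrite [wmaj (x :: _)]/= ltnNge hxy.
Qed.

Lemma word_gf_last0 n a b c i : word_gf_last 0 n a.+1 b c i = word_gf n a b c i.
Proof.
by apply: eq_big => w; rewrite ?shape3_cons0.
Qed.

(** The letter before a final 1 decides: 0 gives a new descent, 1 and 2 give none. *)
Lemma word_gf_last1 n a b c i : (b < a)%N ->
  word_gf_last 1 n.+1 a b.+1 c i =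
  shift n.+1 (word_gf_last 0 n a b c) i + word_gf_last 1 n a b c i
  + word_gf_last 2 n a b c i.
Proof.
move=> hab; rewrite /word_gf_last sum_words_cons !big_cons big_nil addr0 addrA.
rewrite -(@sum_words_descent 1) // -[X in _ = _ + X + _](@sum_words_ascent 1) //.
rewrite -[X in _ = _ + _ + X](@sum_words_ascent 1) //.
by congr (_ + _ + _); apply: eq_bigl => w; rewrite shape3_cons1.
Qed.

Lemma word_gf_last2_0 n a b i : word_gf_last 2 n a b 0 i = 0.
Proof. by rewrite /word_gf_last big_pred0 // => w; rewrite shape3_cons2_0. Qed.

Lemma word_gf_last1_0 n a c i : word_gf_last 1 n a 0 c i = 0.
Proof. by rewrite /word_gf_last big_pred0 // => w; rewrite shape3_cons1_0. Qed.

Lemma word_gf_last2 n a b i : (0 < b)%N ->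
  word_gf_last 2 n.+1 a b 1 i = shift n.+1 (word_gf n.+1 a b 0) i.
Proof.
move=> hb; rewrite /word_gf_last sum_words_cons !big_cons big_nil addr0.
(* The content allows a single 2, so the letter before it is 0 or 1, and both give a descent. *)
rewrite [X in _ + (_ + X)]big_pred0 => [|w]; last by rewrite shape3_cons2 // shape3_cons2_0.
rewrite addr0 (@sum_words_descent 2 0 n (fun w => shape3 a b 1 [:: 2, 0 & w]%N)) //.
rewrite (@sum_words_descent 2 1 n (fun w => shape3 a b 1 [:: 2, 1 & w]%N)) //.
case: i => [|i] /=; first by rewrite addr0.
rewrite word_gf_split word_gf_last2_0 addr0 -mulrDr.
by congr (_ * (_ + _)); apply: eq_bigl => w; rewrite shape3_cons2.
Qed.

(** For a final 1, the words without a new descent are, once it is removed, all words of content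
    [(a.+1, b, c)] except those ending in 0; the latter give the subtracted term and, with a descent
    added, the shifted one. *)
Lemma word_gf_rec n a b c i : (b <= a)%N ->
  word_gf n.+2 a.+1 b.+1 c i =
  word_gf n.+1 a b.+1 c i + word_gf n.+1 a.+1 b c i - word_gf n a b c i
  + shift n.+1 (word_gf n a b c) i + word_gf_last 2 n.+1 a.+1 b.+1 c i.
Proof.
move=> hab; rewrite word_gf_split word_gf_last0 word_gf_last1 //.
rewrite (word_gf_split n a.+1 b) word_gf_last0.
have -> : shift n.+1 (word_gf_last 0 n a.+1 b c) i = shift n.+1 (word_gf n a b c) i.
  by case: i => //= i; rewrite word_gf_last0.
ring.
Qed.

Lemma word_gf_eq0 n a b c i : ~~ (c <= b <= a)%N -> word_gf n a b c i = 0.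
Proof.
move=> h; rewrite /word_gf big_pred0 // => w; apply/negbTE/negP => /andP[/shape3_le].
by rewrite (negbTE h).
Qed.

Lemma word_gf_row a i : word_gf a a 0 0 i = (i == 0)%N%:R.
Proof.
elim: a => [|a IH]; last first.
  by rewrite word_gf_split word_gf_last0 word_gf_last1_0 word_gf_last2_0 !addr0.
by rewrite /word_gf /= big_cons big_nil; case: i => [|i]; rewrite /= ?addr0.
Qed.

(** * Closed forms and their recursions *)

Lemma qpochS n : qpoch q n.+1 = qpoch q n * (1 - q ^+ n.+1).
Proof. by rewrite /qpoch big_nat_recr. Qed.

Lemma qpoch_neq0 n : qpoch q n != 0.
Proof.
elim: n => [|n IH]; first by rewrite /qpoch big_geq // oner_neq0.
by rewrite qpochS mulf_neq0.
Qed.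

Lemma qbinom0 n : qbinom q n 0 = 1.
Proof. by rewrite /qbinom subn0 [qpoch q 0]big_geq // mul1r divff ?qpoch_neq0. Qed.

Lemma qbinomSS A B :
  qbinom q A.+1 B.+1 = qbinom q A B * (1 - q ^+ A.+1) / (1 - q ^+ B.+1).
Proof.
rewrite /qbinom ltnS subSS; case: ifP => _; last by rewrite !mul0r.
rewrite !qpochS; field.
by rewrite !qpoch_neq0 !qn.
Qed.

(** The difference [q ^+ B - q ^+ A] makes this valid for all [A] and [B]: it vanishes at [A = B],
    and both binomials vanish for [A < B]. *)
Lemma qbinomS A B :
  qbinom q A B.+1 = qbinom q A B * (q ^+ B - q ^+ A) / (q ^+ B * (1 - q ^+ B.+1)).
Proof.
rewrite /qbinom; case: (ltngtP B A) => hBA; last 1 first.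
- by rewrite hBA subrr mulr0 mul0r.
- have -> : (A - B = (A - B.+1).+1)%N by lia.
  have -> : q ^+ A = q ^+ B * q ^+ (A - B.+1).+1 by rewrite -exprD; congr (_ ^+ _); lia.
  rewrite !qpochS; field.
  by rewrite !qpoch_neq0 !qn expf_neq0.
- by rewrite !mul0r.
Qed.

(* The factor [q ^+ k - q ^+ m.+1] stands for [q ^+ k * (1 - q ^+ (m - k + 1))]:
   it vanishes at [k = m + 1], where truncated subtraction would not. *)
Definition gf2 (m k i : nat) : F :=
  if k is k'.+1 then
    if i is j.+1 then
      q ^+ (j * j + j) * (q ^+ k - q ^+ m.+1) / (1 - q ^+ j.+1)
      * qbinom q k' j * qbinom q m j
    else 0
  else (i == 0)%N%:R.

Definition gf3 (m k i : nat) : F :=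
  if i is j.+1 then
    q ^+ (j * j + 1) * (q ^+ k - q ^+ m.+1) * (1 - q ^+ j)
    / ((1 - q ^+ j.+1) * (1 - q)) * qbinom q k j * qbinom q m.+1 j
  else 0.

Lemma gf2_rec a b i : 
  gf2 a.+1 b.+1 i = gf2 a b.+1 i + gf2 a.+1 b i - gf2 a b i
    + shift (a + b).+1 (gf2 a b) i.
Proof.
have q1 := qn 0; rewrite expr1 in q1.
case: i => [|[|j]] /=.
(* For [i = 0] and [i = 1] the boundary values [gf2 _ _ 0] enter, which lie outside the q-binomial
   formula. *)
- by case: b => [|b] /=; ring.
- case: b => [|b]; rewrite /= !qbinom0 ?addn0 !expr1 !exprS; field; exact: q1.
case: b => [|b] /=; first by rewrite /qbinom /=; ring.
have hj := qn j; have hj1 := qn j.+1; have zj : q ^+ j != 0 by rewrite expf_neq0.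
(* All binomials become multiples of [qbinom q b j] and [qbinom q a j]; what remains is rational in
   [q], [q ^+ j], [q ^+ a] and [q ^+ b]. *)
rewrite !(qbinomSS _ j) !(qbinomS _ j).
rewrite (_ : j.+1 * j.+1 + j.+1 = (j * j + j) + j + j + 2)%N; last by lia.
rewrite !addnS !exprS !exprD in hj hj1 *.
set U := qbinom q b j; set V := qbinom q a j.
move: (q ^+ (j * j)) (q ^+ j) (q ^+ a) (q ^+ b) U V hj hj1 zj q1 => X z A B U V hj hj1 zj q1.
field.
by rewrite hj hj1 zj.
Qed.

Lemma gf3_rec a b i :
  gf3 a.+1 b.+1 i = gf3 a b.+1 i + gf3 a.+1 b i - gf3 a b i
    + shift (a + b).+2 (gf3 a b) i + shift (a + b).+2 (gf2 a.+1 b.+1) i.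
Proof.
have q1 := qn 0; rewrite expr1 in q1.
case: i => [|[|j]] /=; first by ring.
  by rewrite !expr0 !subrr !(mulr0, mul0r); ring.
have hj := qn j; have hj1 := qn j.+1; have zj : q ^+ j != 0 by rewrite expf_neq0.
rewrite (qbinomS a.+1 j) (qbinomS b j) (qbinomSS a.+1) (qbinomSS b).
rewrite (_ : j.+1 * j.+1 + 1 = (j * j + j) + j + 2)%N; last by lia.
rewrite (_ : q ^+ (j * j + 1) = q ^+ (j * j) * q); last by rewrite exprD.
rewrite !addnS !exprS !exprD in hj hj1 *.
set U := qbinom q b j; set V := qbinom q a.+1 j.
move: (q ^+ (j * j)) (q ^+ j) (q ^+ a) (q ^+ b) U V hj hj1 zj q1 => X z A B U V hj hj1 zj q1.
field.
by rewrite hj hj1 zj q1.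
Qed.

(** * Word sums equal the closed forms *)

Lemma gf2_diag m i : gf2 m m.+1 i = 0.
Proof. by case: i => [|j] //=; rewrite subrr mulr0 !mul0r. Qed.

Lemma gf3_diag m i : gf3 m m.+1 i = 0.
Proof. by case: i => [|j] //=; rewrite subrr mulr0 !mul0r. Qed.

Lemma gf3_0 m i : gf3 m 0 i = 0.
Proof.
by case: i => [|[|j]] //=; rewrite ?subrr /qbinom ?(mulr0, mul0r).
Qed.

(** The range includes [k = m.+1], where both sides vanish, because the recursion at a shape with
    equal rows refers to that case. *)
Lemma word_gf2 m k i : (k <= m.+1)%N -> word_gf (m + k) m k 0 i = gf2 m k i.
Proof.
elim: m k i => [|m IHm] k i.
  case: k => [|[|//]] _; first by rewrite addn0 word_gf_row.
  by rewrite gf2_diag word_gf_eq0.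
elim: k i => [|k IHk] i hk; first by rewrite addn0 word_gf_row.
have [hkm|] := leqP k m; last first.
  move=> hmk; have {hk hmk} -> : k = m.+1 by lia.
  by rewrite gf2_diag word_gf_eq0 // ltnn.
rewrite addSn addnS word_gf_rec // word_gf_last2_0 addr0 gf2_rec.
rewrite -addnS IHm // -IHk ?addSnnS ?IHm ?(leqW hkm) //; last exact: leqW.
by case: i => //= i; rewrite IHm // leqW.
Qed.

Lemma word_gf3 m k i : (k <= m.+1)%N -> word_gf (m + k).+1 m k 1 i = gf3 m k i.
Proof.
elim: m k i => [|m IHm] k i.
  case: k => [|[|//]] _; first by rewrite gf3_0 word_gf_eq0.
  by rewrite gf3_diag word_gf_eq0.
elim: k i => [|k IHk] i hk; first by rewrite gf3_0 word_gf_eq0.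
have [hkm|] := leqP k m; last first.
  move=> hmk; have {hk hmk} -> : k = m.+1 by lia.
  by rewrite gf3_diag word_gf_eq0 // ltnn.
rewrite addSn addnS word_gf_rec // word_gf_last2 // gf3_rec.
rewrite -[in LHS]addnS IHm // addnS -addSn IHk; last exact: leqW.
rewrite IHm; last exact: leqW.
case: i => //= i; rewrite IHm; last exact: leqW.
(* Removing the final 2 leaves words of two-row shape. *)
by have := word_gf2 i (leqW hkm : k.+1 <= m.+2)%N; rewrite addSn addnS => ->.
Qed.

End GF.

(** * Specialization to rational functions in one variable *)

Lemma qvar_neq0 : qvar != 0.
Proof. by rewrite tofrac_eq0 polyX_eq0. Qed.

Lemma one_sub_qvar_neq0 n : 1 - qvar ^+ n.+1 != 0.
Proof.
rewrite -tofracXn -tofrac1 -tofracB tofrac_eq0 subr_eq0 eq_sym.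
by apply/eqP => /(congr1 (fun p : {poly rat} => size p)); rewrite size_polyXn size_poly1.
Qed.

Theorem theorem6 (m k i : nat) (hk : (1 <= k)%N) (hkm : (k <= m)%N)
    (hi : (1 <= i)%N) :
  let q : ratfun := qvar in
  des_maj_gf q [:: m; k; 1%N] i =
    q ^+ (k + i ^ 2 - 2 * i + 2)
    * ((1 - q ^+ (m - k + 1)) * (1 - q ^+ (i - 1)) / ((1 - q ^+ i) * (1 - q)))
    * qbinom q k (i - 1) * qbinom q (m + 1) (i - 1).
Proof.
move=> q; rewrite des_maj_gf_words /=; last by rewrite /= hkm hk.
have := word_gf3 qvar_neq0 one_sub_qvar_neq0 i (leqW hkm).
rewrite /word_gf /shape3 (_ : (m + k).+1 = (m + (k + (1 + 0))))%N; last by lia.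
move=> ->.
case: i hi => // j _; rewrite /gf3 subn1 !addn1 -/q [j.+1.-1]/=.
have -> : q ^+ k - q ^+ m.+1 = q ^+ k * (1 - q ^+ (m - k).+1).
  by rewrite mulrBr mulr1 -exprD; congr (_ - _ ^+ _); lia.
(* With [i = j.+1] this is $i^2-2i+2 = j^2+1$; the natural subtraction does not truncate because [k]
   is positive. *)
have -> : (k + j.+1 ^ 2 - 2 * j.+1 + 2 = (j * j).+1 + k)%N by rewrite -mulnn; lia.
by rewrite [q ^+ (_ + k)]exprD; ring.
Qed.
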